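(* A simple connected graph $G$ is a Boolean graph if and only if the following conditions hold: (1) The graph $G$ is uniquely determined, i.e. for all vertices $x,y$ of $G$, $N(x)=N(y)$ implies $x=y$. (2) The graph $G$ is uniquely complemented. (3) For any $x,y\in V(G)$ with $N(x)\cap N(y)\neq\emptyset$, there exists some $z\in V(G)$ such that $N(x)\cap N(y)=N(z)$. (4) The graph $G$ has a corresponding Boolean semigroup, i.e. there exists a Boolean zero-divisor semigroup $S$ such that $\Gamma(S)\cong G$.
   Context: $N(x)$ is the set of vertices adjacent to $x$. A Boolean ring is a ring $R$ with identity in which $r^2=r$ for all $r\in R$. All semigroups are commutative, written multiplicatively, and have a zero element $0$ with $0x=0$ for all $x$. A zero-divisor semigroup is such a semigroup $S$ in which every element is a zero-divisor (an element $x$ with $xy=0$ for some nonzero $y\in S$). A semigroup $S$ is Boolean if $r^2=r$ for all $r\in S$. For a commutative ring or a commutative semigroup with zero $S$, the zero-divisor graph $\Gamma(S)$ is the undirected simple graph whose vertices are the nonzero zero-divisors of $S$, with distinct vertices $x,y$ adjacent if and only if $xy=0$. A simple graph $G$ is a Boolean graph if it is (isomorphic to) the zero-divisor graph of some Boolean ring. For vertices $x,y$ of a graph, write $x\perp y$ if $x\neq y$, $x$ and $y$ are adjacent, and the edge $x-y$ is not part of any triangle. $G$ is complemented if for each vertex $x$ there exists a vertex $y$ with $x\perp y$. $G$ is uniquely complemented if it is complemented and whenever $x\perp y$ and $x\perp z$, then $N(y)=N(z)$. *)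

(* Defs.v *)
From mathcomp Require Import all_boot all_algebra.
From mathcomp Require Import boolp classical_sets.
From Stdlib Require Import Relation_Operators.

Set Implicit Arguments.
Unset Strict Implicit.
Unset Printing Implicit Defensive.

Import GRing.Theory.

Local Open Scope classical_set_scope.

Record sgraph := SGraph {
  vertex :> Type;
  adj : vertex -> vertex -> Prop;
  adj_sym : forall x y, adj x y -> adj y x;
  adj_irrefl : forall x, ~ adj x x }.

Section GraphNotions.
Variable G : sgraph.
Implicit Types x y z : G.

Definition nbhd x : set G := [set y | adj x y].

(* As usual, a connected graph has at least one vertex. *)
Definition connected_graph : Prop :=
  inhabited G /\ forall x y, clos_refl_trans G (@adj G) x y.

Definition orth x y : Prop :=
  [/\ x <> y, adj x y & ~ exists z, adj x z /\ adj y z].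

Definition complemented : Prop := forall x, exists y, orth x y.

Definition uniquely_complemented : Prop :=
  complemented /\
  forall x y z, orth x y -> orth x z -> nbhd y = nbhd z.

End GraphNotions.

Definition graph_iso (G H : sgraph) : Prop :=
  exists2 f : G -> H, bijective f & forall x y, adj (f x) (f y) <-> adj x y.

(* The zero-divisor graph only involves a commutative product and an element
   [zero], so that rings and semigroups share the same construction. *)
Section ZeroDivisorGraph.
Variables (T : Type) (zero : T) (mul : T -> T -> T).
Hypothesis mulC : commutative mul.

Definition zero_divisor (x : T) : Prop :=
  exists2 y, y <> zero & mul x y = zero.

Definition nonzero_zero_divisor : Type :=
  {x : T | x <> zero /\ zero_divisor x}.

Definition zd_adj (u v : nonzero_zero_divisor) : Prop :=
  u <> v /\ mul (sval u) (sval v) = zero.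

Lemma zd_adj_sym u v : zd_adj u v -> zd_adj v u.
Proof. by case=> nuv uv0; split; [exact: nesym | rewrite mulC]. Qed.

Lemma zd_adj_irrefl u : ~ zd_adj u u.
Proof. by case. Qed.

Definition zd_graph : sgraph := SGraph zd_adj_sym zd_adj_irrefl.

End ZeroDivisorGraph.

Definition boolean_ring (R : pzRingType) : Prop := forall r : R, (r * r = r)%R.

Lemma boolean_ring_mulC (R : pzRingType) :
  boolean_ring R -> commutative (@GRing.mul R).
Proof.
move=> idem x y.
have addxx (r : R) : (r + r = 0)%R.
  apply: (addrI (r + r)%R); rewrite addr0.
  by rewrite -[RHS]idem mulrDl !mulrDr !idem.
have xyyx : (x * y + y * x = 0)%R.
  apply: (addrI x); apply: (addIr y); rewrite addr0.
  by rewrite -[RHS]idem mulrDl !mulrDr !idem !addrA.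
by apply: (addIr (y * x)%R); rewrite xyyx addxx.
Qed.

Definition boolean_graph (G : sgraph) : Prop :=
  exists (R : pzRingType) (boolR : boolean_ring R),
    graph_iso G (zd_graph 0%R (boolean_ring_mulC boolR)).

Record zero_semigroup := ZeroSemigroup {
  zs_sort :> semigroupType;
  zs_zero : zs_sort;
  zs_mulC : forall x y : zs_sort, (x * y = y * x)%g;
  zs_mul0 : forall x : zs_sort, (zs_zero * x = zs_zero)%g }.

Definition zero_divisor_semigroup (S : zero_semigroup) : Prop :=
  forall x : S, zero_divisor (zs_zero S) ( *%g) x.

Definition boolean_semigroup (S : zero_semigroup) : Prop :=
  forall r : S, (r * r = r)%g.

Definition semigroup_graph (S : zero_semigroup) : sgraph :=
  zd_graph (zs_zero S) (@zs_mulC S).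

(* Main.v *)
From HB Require Import structures.
Require Import Defs.
From mathcomp Require Import all_boot all_algebra.
From mathcomp Require Import boolp classical_sets.

(** In a Boolean ring [R] the nonzero zero-divisors are the elements other
than [0] and [1], and [y] is adjacent to [x] exactly when [y] is a nonzero
element below [1 - x].  Hence the neighbourhood of [x] remembers [x], the only
[y] with [orth x y] is [1 - x], a nonempty common neighbourhood of [x] and [y]
is the neighbourhood of the join [x + y + x * y], and the proper part [R \ {1}]
is a Boolean semigroup with the same graph ([boolean_ring_graph_conditions],
[proper_graph_iso]).

Conversely, let [S] be a Boolean zero-divisor semigroup whose graph is
complemented and determined by its neighbourhoods.  A Boolean semigroup is a
meet-semilattice with a least element.  If [orth x y] in the graph, then [y] is
the pseudocomplement of [x] in [S]: when [x * z = 0] and [z <> 0], no nonzero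
element is killed by both [x] and [y], so [z] and [z * y] are killed by the same
elements, and therefore [z = z * y <= y] ([orth_below]).  Since [orth] is
symmetric, [x] is also the pseudocomplement of [y].  Adjoining a unit to [S]
thus gives a bounded meet-semilattice in which each element has a complement of
this two-sided kind.

Such a semilattice is a Boolean algebra (Frink).  The proof here is that
of the Shannon expansion: every expression in meets and complements is local,
in the sense that below an element [s] its value depends only on the parts of
the arguments below [s] ([local_compl]); elements that agree below [s] and below
its complement are equal ([eq_by_parts]); below [x] the argument [x] may be
replaced by [1], and below its complement by [0].  So an identity between
expressions holds everywhere as soon as it holds for arguments [0] and [1]
([shannon]), and the axioms of a Boolean ring for symmetric difference and meet
reduce to truth tables.  Adjoining the unit did not change the zero-divisor
graph ([zd_graph_embedding]), so the ring obtained has graph [G]. *)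

Set Implicit Arguments.
Unset Strict Implicit.
Unset Printing Implicit Defensive.

Import GRing.Theory.

Local Open Scope classical_set_scope.

(** * Semilattices with two-sided pseudocomplements are Boolean rings *)

(** Each of [x], [y] is the largest element whose meet with the other is
[zero]; stating both halves at once makes the double complement of [x] equal
to [x]. *)
Definition complementary (T : Type) (zero : T) (mul : T -> T -> T) (x y : T) :=
  forall z, (mul x z = zero <-> mul z y = z) /\ (mul y z = zero <-> mul z x = z).

Lemma complementary_sym (T : Type) (zero : T) mul x y :
  complementary zero mul x y -> complementary zero mul y x.
Proof. by move=> xy z; have [] := xy z. Qed.

Record complemented_semilattice := ComplementedSemilattice {
  cs_sort :> Type;
  cs_zero : cs_sort;
  cs_one : cs_sort;
  cs_mul : cs_sort -> cs_sort -> cs_sort;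
  cs_mulA : associative cs_mul;
  cs_mulC : commutative cs_mul;
  cs_mul1 : left_id cs_one cs_mul;
  cs_mul0 : left_zero cs_zero cs_mul;
  cs_mulxx : idempotent_op cs_mul;
  cs_compl_ex : forall x, exists y, complementary cs_zero cs_mul x y }.

Declare Scope cs_scope.
Delimit Scope cs_scope with CS.
Notation "0" := (cs_zero _) : cs_scope.
Notation "1" := (cs_one _) : cs_scope.
Notation "x `&` y" := (cs_mul x y) : cs_scope.

Section ComplementedSemilattice.
Variable B : complemented_semilattice.
Implicit Types (s x y z : B) (f g : B -> B).
Local Open Scope cs_scope.

Definition compl x : B := sval (cid (cs_compl_ex x)).
Local Notation "~` x" := (compl x) : cs_scope.

Lemma mul_eq0 x z : x `&` z = 0 <-> z `&` ~` x = z.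
Proof. by rewrite /compl; case: cid => y /= /(_ z) []. Qed.

Lemma mul_compl_eq0 x z : ~` x `&` z = 0 <-> z `&` x = z.
Proof. by rewrite /compl; case: cid => y /= /(_ z) []. Qed.

Lemma mulCA x y z : x `&` (y `&` z) = y `&` (x `&` z).
Proof. by rewrite !cs_mulA (cs_mulC x). Qed.

Lemma mulx0 x : x `&` 0 = 0.
Proof. by rewrite cs_mulC cs_mul0. Qed.

Lemma mulx1 x : x `&` 1 = x.
Proof. by rewrite cs_mulC cs_mul1. Qed.

Lemma mul_compl x : ~` x `&` x = 0.
Proof. by apply/mul_compl_eq0; rewrite cs_mulxx. Qed.

Lemma compl0 : ~` (cs_zero B) = 1.
Proof. by rewrite -[LHS]cs_mul1; apply/mul_eq0; rewrite cs_mul0. Qed.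

Lemma compl1 : ~` (cs_one B) = 0.
Proof. by rewrite -[LHS]mulx1 mul_compl. Qed.

(** An element below neither half of a complementary pair is [0]; applied to
the part of [x] outside [y], which vanishes on both halves, this gives
[x <= y]. *)
Lemma eq_by_parts s x y :
  s `&` x = s `&` y -> ~` s `&` x = ~` s `&` y -> x = y.
Proof.
have below a b : s `&` a = s `&` b -> ~` s `&` a = ~` s `&` b -> a `&` b = a.
  move=> eq1 eq2; apply/mul_compl_eq0.
  have w1 : s `&` (~` b `&` a) = 0 by rewrite mulCA eq1 mulCA mul_compl mulx0.
  have w2 : ~` s `&` (~` b `&` a) = 0
    by rewrite mulCA eq2 mulCA mul_compl mulx0.
  by move/mul_eq0: w1 => <-; rewrite cs_mulC.
by move=> eq1 eq2; rewrite -(below x y) // cs_mulC below.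
Qed.

Definition local f :=
  forall s x y, s `&` x = s `&` y -> s `&` f x = s `&` f y.

Lemma local_id : local id.
Proof. by []. Qed.

Lemma local_cst x : local (fun=> x).
Proof. by []. Qed.

Lemma local_mul f g : local f -> local g -> local (fun x => f x `&` g x).
Proof.
move=> lf lg s x y eqs.
by rewrite cs_mulA (lf _ _ _ eqs) -cs_mulA mulCA (lg _ _ _ eqs) mulCA.
Qed.

(** If [x] and [y] agree below [s], then the part of the complement of [x]
below [s] is disjoint from [y], so it lies below the complement of [y]; the
situation is symmetric in [x] and [y]. *)
Lemma local_compl f : local f -> local (fun x => ~` f x).
Proof.
move=> lf s x y /lf; move: (f x) (f y) => {}x {}y.
have below a b : s `&` a = s `&` b -> s `&` ~` a `&` ~` b = s `&` ~` a.
  move=> eqs; apply/mul_eq0.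
  by rewrite cs_mulA (cs_mulC b) -eqs -cs_mulA (cs_mulC a) mul_compl mulx0.
move=> eqs; rewrite -(below x y) // -[RHS](below y x) //.
by rewrite -!cs_mulA (cs_mulC (~` x)).
Qed.

(** Below [x] the argument [x] may be replaced by [1], below its complement
by [0]. *)
Lemma shannon f g : local f -> local g ->
  f 0 = g 0 -> f 1 = g 1 -> forall x, f x = g x.
Proof.
move=> lf lg eq0 eq1 x; apply: (eq_by_parts (s := x)).
  have eqx : x `&` x = x `&` 1 by rewrite cs_mulxx mulx1.
  by rewrite (lf _ _ _ eqx) (lg _ _ _ eqx) eq1.
have eqx : ~` x `&` x = ~` x `&` 0 by rewrite mul_compl mulx0.
by rewrite (lf _ _ _ eqx) (lg _ _ _ eqx) eq0.
Qed.

(** Symmetric difference, as the part of the join outside the meet. *)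
Definition symdiff x y : B := ~` (~` x `&` ~` y) `&` ~` (x `&` y).

Lemma local_symdiff f g :
  local f -> local g -> local (fun x => symdiff (f x) (g x)).
Proof. by move=> lf lg; do !(apply: local_mul || apply: local_compl). Qed.

Ltac local_tac :=
  solve [repeat first [exact: local_id | exact: local_cst
    | apply: local_symdiff | apply: local_mul | apply: local_compl]].

Ltac truth_table :=
  rewrite /symdiff ?(cs_mul0, mulx0, cs_mul1, mulx1, compl0, compl1) //.

Ltac expand x := move: x; apply: shannon; [local_tac | local_tac | |].

Lemma symdiffC : commutative symdiff.
Proof. by move=> x y; rewrite /symdiff (cs_mulC x) (cs_mulC (~` x)). Qed.

Lemma symdiff0x : left_id (cs_zero B) symdiff.
Proof. by move=> x; expand x; truth_table. Qed.

Lemma symdiffxx x : symdiff x x = 0.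
Proof. by expand x; truth_table. Qed.

Lemma symdiffA : associative symdiff.
Proof. by move=> x y z; expand x; expand y; expand z; truth_table. Qed.

Lemma mul_symdiffl : left_distributive (@cs_mul B) symdiff.
Proof. by move=> x y z; expand z; truth_table. Qed.

End ComplementedSemilattice.

HB.instance Definition _ (B : complemented_semilattice) := gen_eqMixin B.
HB.instance Definition _ (B : complemented_semilattice) := gen_choiceMixin B.
HB.instance Definition _ (B : complemented_semilattice) :=
  GRing.isZmodule.Build (cs_sort B)
    (@symdiffA B) (@symdiffC B) (@symdiff0x B) (@symdiffxx B).
HB.instance Definition _ (B : complemented_semilattice) :=
  GRing.Zmodule_isComPzRing.Build (cs_sort B)
    (@cs_mulA B) (@cs_mulC B) (@cs_mul1 B) (@mul_symdiffl B).

Lemma complemented_semilattice_boolean (B : complemented_semilattice) :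
  boolean_ring (cs_sort B : pzRingType).
Proof. exact: cs_mulxx. Qed.

(** * Graph isomorphisms *)

Lemma graph_iso_sym G H : graph_iso G H -> graph_iso H G.
Proof.
case=> f [g fK gK] adjf; exists g; first by exists f.
by move=> x y; rewrite -adjf !gK.
Qed.

Lemma graph_iso_trans G H K : graph_iso G H -> graph_iso H K -> graph_iso G K.
Proof.
case=> f bijf adjf [g bijg adjg]; exists (g \o f); first exact: bij_comp.
by move=> x y /=; rewrite adjg adjf.
Qed.

Definition graph_conditions (G : sgraph) : Prop :=
  [/\ (forall x y : G, nbhd x = nbhd y -> x = y),
      uniquely_complemented G
    & (forall x y : G, nbhd x `&` nbhd y !=set0 ->
         exists z : G, nbhd x `&` nbhd y = nbhd z)].

Lemma graph_conditions_iso G H :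
  graph_iso G H -> graph_conditions G -> graph_conditions H.
Proof.
case=> f [g fK gK] adjf [twin [cpl uniq] meet].
have nbhdf x : nbhd (f x) = g @^-1` nbhd x.
  have e y : adj (f x) y <-> adj x (g y) by rewrite -{1}(gK y) adjf.
  by apply/seteqP; split=> y /e.
have adjg x y : adj (g x) (g y) <-> adj x y by rewrite -adjf !gK.
have orthf x y : orth (f x) (f y) <-> orth x y.
  split=> -[neq axy tri].
    split; [by move=> eqxy; apply: neq; rewrite eqxy | by rewrite -adjf |].
    by case=> z [xz yz]; apply: tri; exists (f z); rewrite !adjf.
  split; [by move/(can_inj fK) | by rewrite adjf |].
  by case=> z [xz yz]; apply: tri; exists (g z); rewrite -!adjf gK.
have nbhdg x : nbhd (g x) = f @^-1` nbhd x.
  by rewrite -{2}(gK x) nbhdf; apply/seteqP; split=> y /=; rewrite fK.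
split.
- move=> x y eqxy; apply: (can_inj gK); apply: twin.
  by rewrite !nbhdg eqxy.
- split=> [x | x y z].
    by have [y xy] := cpl (g x); exists (f y); rewrite -(gK x) orthf.
  rewrite -(gK x) -(gK y) -(gK z) !orthf => xy xz.
  by rewrite !nbhdf (uniq _ _ _ xy xz).
- move=> x y [z [xz yz]].
  have [|w eqw] := meet (g x) (g y).
    by exists (g z); split; rewrite /nbhd /= adjg.
  by exists (f w); rewrite nbhdf -eqw -(gK x) -(gK y) !nbhdf !gK.
Qed.

(** * Embeddings of zero-divisor graphs *)

(** An embedding whose image contains all zero-divisors creates no new
vertices and loses none.  It applies both to the inclusion of the proper part of
a Boolean ring and to the adjunction of a unit to a semigroup. *)
Lemma zd_graph_embedding (T U : Type) (zT : T) (zU : U)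
    (mulT : T -> T -> T) (mulU : U -> U -> U)
    (mulTC : commutative mulT) (mulUC : commutative mulU) (i : T -> U) :
  injective i -> i zT = zU -> {morph i : x y / mulT x y >-> mulU x y} ->
  (forall u, zero_divisor zU mulU u -> exists x, i x = u) ->
  graph_iso (zd_graph zT mulTC) (zd_graph zU mulUC).
Proof.
move=> injI i0 iM onto.
have zdI x : x <> zT /\ zero_divisor zT mulT x <->
    i x <> zU /\ zero_divisor zU mulU (i x).
  rewrite -i0; split=> -[nx [y ny xy]].
    split; first by move/injI.
    by exists (i y); [move/injI | rewrite -iM xy].
  have nix : x <> zT by move=> eqx; apply: nx; rewrite eqx.
  split=> //; have [z zy] : exists z, i z = y.
    by apply: onto; exists (i x); [rewrite -i0 | rewrite mulUC xy i0].
  exists z; first by move=> eqz; apply: ny; rewrite -zy eqz.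
  by apply: injI; rewrite iM zy.
pose F (u : nonzero_zero_divisor zT mulT) : nonzero_zero_divisor zU mulU :=
  exist _ (i (sval u)) ((zdI _).1 (svalP u)).
have pre (v : nonzero_zero_divisor zU mulU) : exists u, F u = v.
  case: v => v zv; have [x xv] := onto v zv.2.
  have zx : x <> zT /\ zero_divisor zT mulT x by apply/zdI; rewrite xv.
  by exists (exist _ x zx); apply: eq_exist; rewrite /F /=.
have injF : injective F.
  by move=> [u zu] [v zv] /(congr1 sval) /= /injI uv; apply: eq_exist.
pose Finv v := sval (cid (pre v)).
have FinvK : cancel Finv F by move=> v; exact: (svalP (cid (pre v))).
exists F; first by exists Finv => // u; apply: injF; rewrite FinvK.
move=> u v; rewrite /= /zd_adj /= -iM; split=> -[neq eq0].
  by split; [move=> uv; apply: neq; rewrite uv | apply: injI; rewrite i0].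
by split; [move/injF | rewrite eq0].
Qed.

(** * From a Boolean ring to its graph *)

Section BooleanRing.
Variables (R : pzRingType) (boolR : boolean_ring R).
Local Open Scope ring_scope.
Implicit Types x y z : R.

Let mulC := boolean_ring_mulC boolR.
Local Notation gamma := (zd_graph 0 mulC).

Lemma mulr_compl x : x * (1 - x) = 0.
Proof. by rewrite mulrBr mulr1 boolR subrr. Qed.

Lemma boolean_zero_divisor x : zero_divisor 0 *%R x <-> x <> 1.
Proof.
split=> [[y ny xy] x1 | nx].
  by apply: ny; rewrite -xy x1 mul1r.
exists (1 - x); first by move/eqP; rewrite subr_eq0 => /eqP /esym.
exact: mulr_compl.
Qed.

Lemma boolean_adj (u v : gamma) : adj u v <-> sval u * sval v = 0.
Proof.
split=> [[] // | uv]; split=> // eqv.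
by case: v eqv uv => v [nv zv] -> /=; rewrite boolR.
Qed.

Lemma vertexP x : x <> 0 -> x <> 1 -> {u : gamma | sval u = x}.
Proof.
move=> n0 n1; have zx : x <> 0 /\ zero_divisor 0 *%R x.
  by split=> //; apply/boolean_zero_divisor.
by exists (exist _ x zx).
Qed.

Lemma compl_vertex (u : gamma) : {v : gamma | sval v = 1 - sval u}.
Proof.
case: u => u [nu /boolean_zero_divisor zu] /=; apply: vertexP.
  by move/eqP; rewrite subr_eq0 => /eqP /esym.
by move/eqP; rewrite -subr_eq0 addrAC subrr sub0r oppr_eq0 => /eqP.
Qed.

(** For an edge, [u * v = 0] gives [(1 - u) * (1 - v) = 1 - u - v].  This
element is killed by both ends, so it closes a triangle unless it vanishes. *)
Lemma orth_boolean (u v : gamma) : orth u v <-> sval v = 1 - sval u.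
Proof.
split=> [[_ /boolean_adj uv tri] | vE]; last first.
  have uv : adj u v.
    by apply/boolean_adj; rewrite vE mulr_compl.
  split=> //; first by case: uv.
  case=> w [/boolean_adj uw /boolean_adj]; rewrite vE mulrBl mul1r uw subr0.
  by case: w {uw} => w [].
have [w0|nw] := pselect ((1 - sval u) * (1 - sval v) = 0).
  apply/esym/eqP; rewrite -subr_eq0; apply/eqP.
  by rewrite -[RHS]w0 mulrBr mulr1 mulrBl mul1r uv subr0.
have kill x y : x * ((1 - x) * (1 - y)) = 0.
  by rewrite mulrA mulr_compl mul0r.
have [w1|nw1] := pselect ((1 - sval u) * (1 - sval v) = 1).
  have := kill (sval u) (sval v); rewrite w1 mulr1 => u0.
  by case: u u0 {uv tri nw w1} => u [].
have [w wE] := vertexP nw nw1.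
case: tri; exists w; split; apply/boolean_adj; rewrite wE.
  exact: kill.
by rewrite (mulC (1 - _)) kill.
Qed.

Lemma boolean_ring_graph_conditions : graph_conditions gamma.
Proof.
have below (u v : gamma) : nbhd u = nbhd v -> sval v * sval u = sval v.
  move=> eqn; have [w wE] := compl_vertex u.
  have : nbhd v w.
    rewrite -eqn; apply/boolean_adj.
    by rewrite wE mulr_compl.
  by move/boolean_adj; rewrite wE mulrBr mulr1 => /eqP;
    rewrite subr_eq0 => /eqP.
split.
- move=> u v eqn; apply: eq_sig_hprop => [x p q|]; first exact: Prop_irrelevance.
  by rewrite -(below v u) // mulC below.
- split=> [u | u v w /orth_boolean vE /orth_boolean wE].
    by have [v /orth_boolean uv] := compl_vertex u; exists v.
  suff -> : v = w by [].
  apply: eq_sig_hprop => [x p q|]; first exact: Prop_irrelevance.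
  by rewrite vE wE.
(* The common neighbours of [u] and [v] are the neighbours of their join. *)
- move=> u v [w [/boolean_adj uw /boolean_adj vw]].
  pose j := 1 - (1 - sval u) * (1 - sval v).
  have mulj x : sval u * x = 0 -> sval v * x = 0 -> j * x = 0.
    move=> ux vx; rewrite mulrBl mul1r -mulrA.
    by rewrite (mulrBl x 1 (sval v)) vx mul1r subr0 mulrBl ux mul1r subr0 subrr.
  have uj : sval u * j = sval u by rewrite mulrBr mulr1 mulrA mulr_compl mul0r subr0.
  have vj : sval v * j = sval v.
    by rewrite mulrBr mulr1 (mulC (1 - _)) mulrA mulr_compl mul0r subr0.
  have [||z zE] := @vertexP j.
  + by move=> j0; case: (svalP u) => nu _; apply: nu; rewrite -uj j0 mulr0.
  + move=> j1; case: (svalP w) => nw _; apply: nw.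
    by rewrite -[LHS]mul1r -j1 mulj.
  exists z; apply/seteqP; split=> x.
    by case=> /boolean_adj ux /boolean_adj vx; apply/boolean_adj; rewrite zE mulj.
  move=> /boolean_adj; rewrite zE => jx.
  by split; apply/boolean_adj; [rewrite -uj | rewrite -vj]; rewrite -mulrA jx mulr0.
Qed.

(** The unit is not a zero-divisor and every other element is, so removing it
leaves a zero-divisor semigroup; idempotence is what makes [1] indecomposable,
hence the remaining part closed under products. *)
Definition proper_part : Type := {x : R | x <> 1}.

Lemma mul_proper (a b : proper_part) : sval a * sval b <> 1.
Proof.
case: a b => a na [b nb] /= ab; apply: na.
by rewrite -[LHS]mulr1 -ab mulrA boolR.
Qed.

Definition proper_mul (a b : proper_part) : proper_part :=
  exist _ (sval a * sval b) (@mul_proper a b).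

Lemma proper_inj (a b : proper_part) : sval a = sval b -> a = b.
Proof. by case: a b => a na [b nb] /= ab; apply: eq_exist. Qed.

Lemma proper_mulA : associative proper_mul.
Proof. by move=> a b c; apply: proper_inj; rewrite /= mulrA. Qed.

HB.instance Definition _ := gen_eqMixin proper_part.
HB.instance Definition _ := gen_choiceMixin proper_part.
HB.instance Definition _ := isSemigroup.Build proper_part proper_mulA.

(** In the ring with two elements [0] would be the only element of the proper
part, and not a zero-divisor there; a vertex excludes this ring as well as
the trivial one. *)
Variable u0 : gamma.

Lemma neq01 : 0 <> 1 :> R.
Proof.
by case: (svalP u0) => nu _ eq01; apply: nu; rewrite -[LHS]mulr1 -eq01 mulr0.
Qed.

Definition proper0 : proper_part := exist _ 0 neq01.

Lemma proper_mulC (a b : proper_part) : (a * b = b * a)%g.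
Proof. by apply: proper_inj; exact: mulC. Qed.

Lemma proper_mul0 (a : proper_part) : (proper0 * a = proper0)%g.
Proof. by apply: proper_inj; exact: mul0r. Qed.

Definition proper_semigroup : zero_semigroup :=
  ZeroSemigroup proper_mulC proper_mul0.

Lemma proper_boolean : boolean_semigroup proper_semigroup.
Proof. by move=> a; apply: proper_inj; exact: boolR. Qed.

Lemma proper_zero_divisor : zero_divisor_semigroup proper_semigroup.
Proof.
case=> x nx; have [x0|n0] := pselect (x = 0).
  case: (svalP u0) => nu /boolean_zero_divisor u1.
  exists (exist _ (sval u0) u1); first by move/(congr1 sval).
  by apply: proper_inj; rewrite /= /proper_mul /= x0 mul0r.
have nc : 1 - x <> 1.
  by move/eqP; rewrite -subr_eq0 addrAC subrr sub0r oppr_eq0 => /eqP.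
exists (exist _ (1 - x) nc); last by apply: proper_inj; exact: mulr_compl.
by move/(congr1 sval) => /= /eqP; rewrite subr_eq0 => /eqP /esym.
Qed.

Lemma proper_graph_iso : graph_iso (semigroup_graph proper_semigroup) gamma.
Proof.
apply: (@zd_graph_embedding _ _ _ _ _ _ _ _ sval) => //.
  by move=> a b; exact: proper_inj.
by move=> x /boolean_zero_divisor nx; exists (exist _ x nx).
Qed.

End BooleanRing.

(** * From the graph of a Boolean semigroup to a Boolean ring *)

Section BooleanSemigroup.
Variable S : zero_semigroup.
Hypotheses (boolS : boolean_semigroup S) (zdS : zero_divisor_semigroup S).
Local Notation gamma := (semigroup_graph S).
Hypothesis twin_free : forall u v : gamma, nbhd u = nbhd v -> u = v.
Hypothesis cpl : complemented gamma.
Local Notation "0" := (zs_zero S) : group_scope.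
Local Open Scope group_scope.
Implicit Types x y z : S.

Definition semigroup_vertex x (nx : x <> 0) : gamma :=
  exist _ x (conj nx (zdS x)).

Lemma semigroup_adj (u v : gamma) : adj u v <-> sval u * sval v = 0.
Proof.
split=> [[] // | uv]; split=> // eqv.
by case: v eqv uv => v [nv zv] -> /=; rewrite boolS.
Qed.

Lemma zs_mulx0 x : x * 0 = 0.
Proof. by rewrite zs_mulC zs_mul0. Qed.

(** As [u - v] lies in no triangle, no nonzero element is killed by both ends.
For [z] killed by [u], an element [w] with [w * (z * v) = 0] makes [w * z]
killed by both, so [z] and [z * v] have the same neighbours. *)
Lemma orth_below (u v : gamma) : orth u v ->
  forall z, sval u * z = 0 <-> z * sval v = z.
Proof.
move=> [_ /semigroup_adj uv tri] z.
have kill w : sval u * w = 0 -> sval v * w = 0 -> w = 0.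
  move=> uw vw; apply: contrapT => nw; apply: tri.
  by exists (semigroup_vertex nw); split; apply/semigroup_adj.
split=> [uz | <-]; last by rewrite (zs_mulC z) mulgA uv zs_mul0.
have [->|nz] := pselect (z = 0); first by rewrite zs_mul0.
have nzv : z * sval v <> 0.
  by move=> zv0; apply: nz; apply: kill => //; rewrite zs_mulC.
suff /(congr1 sval) : semigroup_vertex nzv = semigroup_vertex nz by [].
apply: twin_free; apply/seteqP; split=> w /semigroup_adj /= zw;
  apply/semigroup_adj => /=.
  apply: kill; first by rewrite mulgA uz zs_mul0.
  by rewrite mulgA (zs_mulC _ z).
by rewrite (zs_mulC z) -mulgA zw zs_mulx0.
Qed.

(** [None] is the adjoined unit; it is the complement of the zero of [S], which
has no complement in [S] itself. *)
Definition unitize_mul (a b : option S) : option S :=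
  match a, b with
  | Some x, Some y => Some (x * y)
  | None, _ => b
  | _, None => a
  end.

Lemma unitize_mulA : associative unitize_mul.
Proof. by case=> [x|] [y|] [z|] //=; rewrite mulgA. Qed.

Lemma unitize_mulC : commutative unitize_mul.
Proof. by case=> [x|] [y|] //=; rewrite zs_mulC. Qed.

Lemma unitize_mul1 : left_id None unitize_mul.
Proof. by []. Qed.

Lemma unitize_mul0 : left_zero (Some 0) unitize_mul.
Proof. by case=> [x|] //=; rewrite zs_mul0. Qed.

Lemma unitize_mulxx : idempotent_op unitize_mul.
Proof. by case=> [x|] //=; rewrite boolS. Qed.

Lemma unitize_complementary01 : complementary (Some 0) unitize_mul (Some 0) None.
Proof.
by case=> [z|] /=; rewrite ?zs_mul0 ?zs_mulx0; split; split.
Qed.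

Lemma unitize_compl_ex (a : option S) :
  exists b, complementary (Some 0) unitize_mul a b.
Proof.
case: a => [x|]; last first.
  by exists (Some 0); exact/complementary_sym/unitize_complementary01.
have [->|nx] := pselect (x = 0).
  by exists None; exact: unitize_complementary01.
have [v uv] := cpl (semigroup_vertex nx).
have vu : orth v (semigroup_vertex nx).
  case: uv => neq /adj_sym vu tri; split=> //; first exact: nesym.
  by case=> w [vw uw]; apply: tri; exists w.
exists (Some (sval v)) => -[z|] /=; last first.
  split; split=> // -[]; first by move/nx.
  by case: (svalP v) => nv _ /nv.
have := orth_below uv z; have := orth_below vu z; rewrite /= => vuz uvz.
by split; split=> -[e]; congr Some; first [exact/uvz | exact/vuz].
Qed.

Definition unitize : complemented_semilattice :=
  ComplementedSemilattice unitize_mulA unitize_mulC unitize_mul1 unitize_mul0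
    unitize_mulxx unitize_compl_ex.

Lemma unitize_graph_iso :
  graph_iso gamma (zd_graph (0%R : unitize)
    (boolean_ring_mulC (@complemented_semilattice_boolean unitize))).
Proof.
apply: (@zd_graph_embedding _ _ _ _ _ _ _ _ (@Some S)) => //; first by move=> x y [].
by case=> [x|] [y ny xy]; [exists x | case: ny].
Qed.

End BooleanSemigroup.

Theorem theorem3p7 (G : sgraph) (connG : connected_graph G) :
  boolean_graph G <->
  [/\ (forall x y : G, nbhd x = nbhd y -> x = y),
      uniquely_complemented G,
      (forall x y : G, nbhd x `&` nbhd y !=set0 ->
         exists z : G, nbhd x `&` nbhd y = nbhd z)
    & exists S : zero_semigroup,
        [/\ boolean_semigroup S, zero_divisor_semigroup S
          & graph_iso (semigroup_graph S) G]].
Proof.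
split=> [[R [boolR isoG]] | [twin uniq meet [S [boolS zdS isoS]]]].
  have [|? ? ?] := graph_conditions_iso (graph_iso_sym isoG).
    exact: boolean_ring_graph_conditions.
  split=> //; case: connG => -[x] _; case: (isoG) => f _ _.
  exists (proper_semigroup (f x)); split.
  - exact: proper_boolean.
  - exact: proper_zero_divisor.
  - exact: graph_iso_trans (proper_graph_iso _) (graph_iso_sym isoG).
have [|twinS [cplS _] _] := graph_conditions_iso (graph_iso_sym isoS).
  by split.
exists _, (@complemented_semilattice_boolean (unitize boolS zdS twinS cplS)).
apply: graph_iso_trans (graph_iso_sym isoS) _.
exact: unitize_graph_iso.
Qed.
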